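(* There is an absolute constant $c$ such that, for all integers $r\ge 2$, $d\ge 1$ and $s_{1},\ldots,s_{r}\ge 1$, writing $\boldsymbol{s}=(s_{1},\ldots,s_{r})$, $$g_{r}(d,s_{1},\ldots,s_{r})\le c\,d\,T_{d,r}(\boldsymbol{s})\log\bigl(e\,r\,T_{d,r}(\boldsymbol{s})\bigr).$$
   Context: A set in $\mathbb{R}^{d}$ is called $s$-convex if it is a union of at most $s$ convex sets. Write $[n]=\{1,\ldots,n\}$. Let $g_{r}(d,s_{1},\ldots,s_{r})$ be the least $m$ with the following property: whenever $A_{1},\ldots,A_{m}\subseteq\mathbb{R}^{d}$ are pairwise disjoint sets of size $r$, there is a labeled partition $A_{1}\sqcup\cdots\sqcup A_{m}=P_{1}\sqcup\cdots\sqcup P_{r}$ such that $|P_{i}\cap A_{j}|=1$ for every $i\in[r]$ and $j\in[m]$, and such that every choice of $s_{i}$-convex sets $C_{i}\supseteq P_{i}$, $i\in[r]$, satisfies $\bigcap_{i=1}^{r}C_{i}\ne\emptyset$. Put $S(\boldsymbol{s})=\prod_{i=1}^{r}s_{i}$, $q=\min\{r,d+1\}$, $$H_{d,r}(\boldsymbol{s})=\sum_{\emptyset\ne I\subseteq[r],\ |I|\le d+1}|I|\prod_{i\in I}s_{i},\qquad T_{d,r}(\boldsymbol{s})=\min\{q\,S(\boldsymbol{s}),\,H_{d,r}(\boldsymbol{s})\}.$$ Here $\log$ is the natural logarithm and $e$ its base. *)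

(* Defs.v *)
From mathcomp Require Import all_boot all_order all_algebra.
From mathcomp Require Import all_classical all_reals all_analysis.

Set Implicit Arguments.
Unset Strict Implicit.
Unset Printing Implicit Defensive.

Import Order.TTheory GRing.Theory Num.Theory.
Local Open Scope classical_set_scope.
Local Open Scope card_scope.
Local Open Scope ring_scope.

Definition s_convex (R : realType) (d s : nat) (C : set 'rV[R]_d) : Prop :=
  exists2 k : nat, (k <= s)%N &
  exists2 F : 'I_k -> set 'rV[R]_d,
    (forall j, convex_set (F j)) & C = \bigcup_j F j.

Definition rainbow_partition (R : realType) (d r m : nat)
    (A : 'I_m -> set 'rV[R]_d) (P : 'I_r -> set 'rV[R]_d) : Prop :=
  [/\ \bigcup_i P i = \bigcup_j A j,
      trivIset setT P &
      forall i j, P i `&` A j #= `I_1].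

Definition colorful_tverberg (R : realType) (d r : nat) (s : 'I_r -> nat)
    (m : nat) : Prop :=
  forall A : 'I_m -> set 'rV[R]_d,
    (forall j, A j #= `I_r) -> trivIset setT A ->
  exists2 P : 'I_r -> set 'rV[R]_d,
    rainbow_partition A P &
    forall C : 'I_r -> set 'rV[R]_d,
      (forall i, s_convex (s i) (C i)) -> (forall i, P i `<=` C i) ->
      \bigcap_i C i !=set0.

(* [is_g R d s m] is the equation g_r(d, s_1, ..., s_r) = m over R^d; it is a
   relation because the existence of an admissible m is not known a priori. *)
Definition is_g (R : realType) (d r : nat) (s : 'I_r -> nat) (m : nat) : Prop :=
  colorful_tverberg R d s m /\
  forall k : nat, colorful_tverberg R d s k -> (m <= k)%N.

Definition Sprod (r : nat) (s : 'I_r -> nat) : nat := (\prod_(i < r) s i)%N.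

Definition Hsum (d r : nat) (s : 'I_r -> nat) : nat :=
  (\sum_(I : {set 'I_r} | (I != finset.set0) && (#|I| <= d.+1))
     #|I| * \prod_(i in I) s i)%N.

Definition Tmin (d r : nat) (s : 'I_r -> nat) : nat :=
  minn (minn r d.+1 * Sprod s) (Hsum d s).

(* Main.v *)
Require Import Defs.
From mathcomp Require Import all_boot all_order all_algebra all_fingroup.
From mathcomp Require Import zify ring lra.
From mathcomp Require Import all_classical all_reals all_analysis.
(* Finite sets are used far more than classical sets below, so their names win. *)
From mathcomp Require Import fintype finset.

(** The partition is found at random: each A_j is labelled by an independent
    uniform permutation, and P_i collects the points labelled i.  A labelling
    fails when some s_i-convex sets C_i containing P_i have no common point, and
    the proof counts how few reasons for failure there are.

    Split each C_i into its convex pieces.  A choice of one piece for every i is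
    a family of convex sets without a common point, so by linear programming
    duality (farkas) and Caratheodory's theorem for cones
    (conic_caratheodory), the sample points of at most d+1 of these pieces lie
    in half-spaces that have no common point (transversal_separates).  There are
    S(s) choices, each using at most q half-spaces; alternatively the half-spaces
    can be shared between all choices that agree on the index set I of the pieces
    involved, which leaves H(s) of them.  So in both cases a failure is witnessed
    by T half-spaces (encoding_by_transversals,
    encoding_by_partial_transversals): they determine sets Q_i of sample points
    (region) that contain P_i and have no point common to all i.

    Only the traces of the half-spaces on the n = rm sample points matter.
    Half-spaces of R^d shatter no more than d+1 points, whence by the lemma of
    Sauer and Shelah at most N = C(n,0) + ... + C(n,d+1) traces
    (card_halfspace_traces) and (rN)^T witnesses.

    A fixed witness is compatible with few labellings: every point of A_j is
    missing from some Q_i, hence must avoid the label i, and a random permutation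
    avoids one forbidden label per point with probability at most 1/2
    (perm_avoid_half).  So the witness survives with probability at most 2^-m,
    and a good labelling exists as soon as (rN)^T < 2^m (union_bound).  Since
    ln N is at most (d+1)(1 + ln (n/(d+1))), this holds for m close to
    63 d T ln(e r T) (union_bound_size); dividing n by d+1 inside the logarithm
    is what keeps ln d out of the bound. *)

Set Implicit Arguments.
Unset Strict Implicit.
Unset Printing Implicit Defensive.

(** * Permutations with forbidden values *)

(** Composing with a transposition shows that the value at k is equidistributed. *)
Lemma card_perm_eval (n : nat) (k a : 'I_n) :
  n * #|[set s : 'S_n | s k == a]| = n`!.
Proof.
have le_ab (b c : 'I_n) :
    #|[set s : 'S_n | s k == b]| <= #|[set s : 'S_n | s k == c]|.
  rewrite -(card_imset _ (@mulIg _ (tperm b c))) subset_leq_card //.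
  apply/subsetP => _ /imsetP[s + ->]; rewrite !inE => /eqP sk.
  by rewrite permM sk tpermL.
have eq_ab b : #|[set s : 'S_n | s k == b]| = #|[set s : 'S_n | s k == a]|.
  by apply/eqP; rewrite eqn_leq !le_ab.
rewrite -[RHS](card_Sn n) -[RHS]sum1_card.
rewrite (partition_big (fun s : 'S_n => s k) predT) //=.
rewrite (eq_bigr (fun=> #|[set s : 'S_n | s k == a]|)) => [|b _]; last first.
  by rewrite -(eq_ab b) -sum1_card; apply: eq_bigl => s; rewrite !inE.
by rewrite sum_nat_const card_ord.
Qed.

(** Equality holds when a and b differ: given the value at k, the value at l is
    equidistributed over the n-1 others. *)
Lemma card_perm_eval2 (n : nat) (k l a b : 'I_n) : k != l ->
  n * n.-1 * #|[set s : 'S_n | (s k == a) && (s l == b)]| <= n`!.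
Proof.
move=> kl; pose B c := [set s : 'S_n | (s k == a) && (s l == c)].
have le_cd c e : a != c -> a != e -> #|B c| <= #|B e|.
  move=> ac ae.
  rewrite -(card_imset _ (@mulIg _ (tperm c e))) subset_leq_card //.
  apply/subsetP => _ /imsetP[s + ->]; rewrite !inE => /andP[/eqP sk /eqP sl].
  by rewrite !permM sk sl tpermL tpermD ?eqxx // eq_sym.
have [ab|ab] := eqVneq a b.
  rewrite (_ : [set _ | _] = set0) ?cards0 ?muln0 //.
  apply/setP => s; rewrite !inE -ab; apply/negP => /andP[/eqP <- /eqP].
  by move=> /perm_inj lk; rewrite lk eqxx in kl.
rewrite -/(B b) -(card_perm_eval k a) -mulnA leq_mul2l; apply/orP; right.
rewrite -[leqRHS]sum1_card (partition_big (fun s : 'S_n => s l) (predC1 a)) /=; last first.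
  move=> s; rewrite inE => /eqP <-; apply/eqP => /perm_inj lk.
  by rewrite lk eqxx in kl.
rewrite (eq_bigr (fun c => #|B c|)) => [|c _]; last first.
  by rewrite -sum1_card; apply: eq_bigl => s; rewrite !inE.
apply: (@leq_trans (\sum_(c | c != a) #|B b|)); last first.
  by apply: leq_sum => c ca; rewrite le_cd // eq_sym.
by rewrite sum_nat_const (cardC1 a) card_ord.
Qed.

(** Let N be the number of k with s k = f k.  For a uniform s the mean of N is 1
    and that of N(N-1) is at most 1, so Bonferroni's inequality
    [N >= 1] >= N - N(N-1)/2 bounds the probability of a hit from below by
    1/2, uniformly in f. *)
Lemma perm_avoid_half (n : nat) (f : 'I_n -> 'I_n) : 0 < n ->
  2 * #|[set s : 'S_n | [forall k, s k != f k]]| <= n`!.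
Proof.
move=> n_gt0.
pose h (s : 'S_n) k : nat := s k == f k.
pose N s := \sum_k h s k.
pose M s := \sum_k \sum_(l | k != l) h s k * h s l.
have NM s : N s * N s = M s + N s.
  rewrite /N /M big_distrl /= -big_split /=; apply: eq_bigr => k _.
  rewrite big_distrr /= (bigD1 k) //= addnC; congr (_ + _).
    by apply: eq_bigl => l; rewrite eq_sym.
  by rewrite /h; case: (_ == _).
have sumN : \sum_s N s = n`!.
  apply/eqP; rewrite -(eqn_pmul2l n_gt0); apply/eqP.
  rewrite /N exchange_big /= big_distrr /= (eq_bigr (fun=> n`!)).
    by rewrite sum_nat_const card_ord.
  move=> k _; rewrite -(card_perm_eval k (f k)); congr (_ * _).
  by rewrite -sum1_card [RHS]big_mkcond /=; apply: eq_bigr => s _; rewrite inE /h; case: eqP.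
have sumM : \sum_s M s <= n`!.
  have [n1|n1] := leqP n 1.
    rewrite big1 // => s _; rewrite /M big1 // => k _; rewrite big1 // => l.
    by move=> /negP[]; apply/eqP/val_inj => /=; have := ltn_ord k; have := ltn_ord l; lia.
  have n2 : 0 < n * n.-1 by nia.
  rewrite -(leq_pmul2l n2) /M exchange_big /= big_distrr /=.
  apply: (@leq_trans (\sum_(k < n) \sum_(l < n | k != l) n`!)); last first.
    rewrite (eq_bigr (fun=> n.-1 * n`!)) => [|k _].
      by rewrite sum_nat_const card_ord mulnA.
    rewrite sum_nat_const; congr (_ * _).
    rewrite -[n in RHS]card_ord -(cardC1 k).
    by apply: eq_card => l; rewrite !inE eq_sym.
  apply: leq_sum => k _; rewrite exchange_big /= big_distrr /=.
  apply: leq_sum => l kl; apply: leq_trans (card_perm_eval2 (f k) (f l) kl).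
  rewrite leq_mul2l -sum1_card big_mkcond /= [leqRHS]big_mkcond /=.
  apply/orP; right; apply: leq_sum => s _; rewrite inE /h.
  by do 2!case: eqP.
set Z := [set s | _].
(* Twice Bonferroni's inequality, with M = N(N-1); it amounts to (N-1)(N-2) >= 0. *)
have pt s : 2 * (s \in Z) + 2 * N s <= 2 + M s.
  have -> : s \in Z = (N s == 0).
    rewrite inE /N sum_nat_eq0; apply: eq_forallb => k /=.
    by rewrite /h eqb0.
  have := NM s; case: eqP => [->|]; nia.
have sumZ : \sum_s (s \in Z) = #|Z|.
  by rewrite -sum1_card [RHS]big_mkcond; apply: eq_bigr => s _; case: (s \in Z).
have : \sum_s (2 * (s \in Z) + 2 * N s) <= \sum_s (2 + M s) by apply: leq_sum.
rewrite !big_split /= !big1_eq sumN sumZ sum_nat_const card_Sn.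
have gen a b : a + (a + 0) + (b + (b + 0)) <= b * 2 + b -> 2 * a <= b by lia.
by move=> /leq_trans/(_ (leq_add (leqnn _) sumM)); apply: gen.
Qed.

(** The first moment method: each witness c in G is consistent with at most a
    fraction 2^-m of the labellings s, because it forbids at least one label at
    each point and the m permutations are independent. *)
Lemma union_bound (r m : nat) (C : finType) (G : {set C})
    (Q : C -> 'I_r -> {set 'I_m * 'I_r}) : 0 < r -> #|G| < 2 ^ m ->
  (forall c p, c \in G -> exists i, p \notin Q c i) ->
  exists s : {ffun 'I_m -> 'S_r},
    forall c, c \in G -> exists p, p \notin Q c (s p.1 p.2).
Proof.
move=> r0 Gm hQ.
pose bad c := [set s : {ffun 'I_m -> 'S_r} | [forall p, p \in Q c (s p.1 p.2)]].
have cbad c : c \in G -> 2 ^ m * #|bad c| <= r`! ^ m.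
  move=> cG; pose W (j : 'I_m) := [set t : 'S_r | [forall l, (j, l) \in Q c (t l)]].
  apply: (@leq_trans (2 ^ m * \prod_(j < m) #|W j|)).
    rewrite leq_mul2l; apply/orP; right.
    have -> : \prod_(j < m) #|W j|
        = #|(family (fun j => mem (W j)) : simpl_pred {ffun 'I_m -> 'S_r})|.
      by rewrite card_family foldrE big_map big_enum.
    rewrite subset_leq_card //; apply/subsetP => s; rewrite inE => /forallP hs.
    by apply/familyP => j; rewrite inE; apply/forallP => l; apply: (hs (j, l)).
  rewrite -[m in 2 ^ m]card_ord -[m in leqRHS]card_ord -!prod_nat_const -big_split /=.
  apply: leq_prod => j _; have hf l : exists i, (j, l) \notin Q c i by apply: hQ.
  apply: leq_trans (perm_avoid_half (fun l => xchoose (hf l)) r0).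
  rewrite leq_mul2l /= subset_leq_card //; apply/subsetP => t; rewrite !inE.
  move=> /forallP ht; apply/forallP => l; apply/eqP => tl.
  by have := xchooseP (hf l); rewrite -tl ht.
have cardT : #|{: {ffun 'I_m -> 'S_r}}| = r`! ^ m by rewrite card_ffun card_Sn card_ord.
have [s sP] : exists s, s \notin \bigcup_(c in G) bad c.
  apply/existsP; rewrite -negb_forall; apply/negP => /forallP all_bad.
  have le_sum : r`! ^ m <= \sum_(c in G) #|bad c|.
    have : #|\bigcup_(c in G) bad c| <= \sum_(c in G) #|bad c|.
      elim/big_rec2: _ => [|c n B _ IH]; first by rewrite cards0.
      by apply: leq_trans (leq_card_setU _ _).1 _; rewrite leq_add2l.
    apply: leq_trans; rewrite -cardT subset_leq_card //.
    by apply/subsetP => s _; apply: all_bad.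
  have : 2 ^ m * r`! ^ m <= #|G| * r`! ^ m.
    apply: leq_trans (_ : 2 ^ m * \sum_(c in G) #|bad c| <= _).
      by rewrite leq_mul2l le_sum orbT.
    by rewrite big_distrr -sum_nat_const; apply: leq_sum => c /cbad.
  by rewrite leq_pmul2r ?expn_gt0 ?fact_gt0 // leqNgt Gm.
exists s => c cG; apply/existsP; rewrite -negb_forall; apply: contra sP => hs.
by apply/bigcupP; exists c => //; rewrite inE.
Qed.

(** * Shattered sets *)

Definition shattered (T : finType) (F : {set {set T}}) (S : {set T}) : bool :=
  [forall B : {set T}, (B \subset S) ==> [exists A in F, A :&: S == B]].

Lemma shatteredP (T : finType) (F : {set {set T}}) (S : {set T}) :
  reflect (forall B : {set T}, B \subset S -> exists2 A, A \in F & A :&: S = B)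
          (shattered F S).
Proof.
apply: (iffP forallP) => [h B BS|h B].
  have := h B; rewrite BS => /existsP[A /andP[AF /eqP AB]].
  by exists A.
by apply/implyP => /h[A AF AB]; apply/existsP; exists A; rewrite AF AB eqxx.
Qed.

(** Pajor's form of the Sauer-Shelah lemma, by induction on the ground set.  To
    remove a point x, split F into the members without x (G0) and the traces of
    the members with x (G1).  A set shattered by G0 or by G1 is shattered by F,
    and a set shattered by both remains so after x is added. *)
Lemma pajor (T : finType) (F : {set {set T}}) :
  #|F| <= #|[set S | shattered F S]|.
Proof.
suff gen n (U : {set T}) (G : {set {set T}}) : #|U| = n ->
    (forall A, A \in G -> A \subset U) -> #|G| <= #|[set S | shattered G S]|.
  by apply: (gen #|[set: T]| [set: T]) => // A _; apply: subsetT.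
elim: n U G => [|n IHn] U G cU GU.
  have [->|[A AG]] := set_0Vmem G; first by rewrite cards0.
  have GA B : B \in G -> B = set0.
    by move/GU; move/eqP: cU; rewrite cards_eq0 => /eqP ->; rewrite subset0 => /eqP.
  apply: (@leq_trans #|[set (set0 : {set T})]|).
    by rewrite subset_leq_card //; apply/subsetP => B /GA ->; rewrite inE.
  rewrite subset_leq_card //; apply/subsetP => B; rewrite !inE => /eqP ->.
  apply/shatteredP => B'; rewrite subset0 => /eqP ->; exists A => //.
  by rewrite setI0.
have [x xU] : exists x, x \in U by apply/card_gt0P; rewrite cU.
pose G0 := [set A in G | x \notin A].
pose G1 := [set A :\ x | A in [set A in G | x \in A]].
have cG : #|G| = #|G0| + #|G1|.
  rewrite card_in_imset => [|A B]; last first.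
    rewrite !inE => /andP[_ xA] /andP[_ xB] AB.
    by rewrite -(setD1K xA) AB setD1K.
  rewrite addnC -(cardsID [set A : {set T} | x \in A]) /G0; congr (_ + _);
    by apply: eq_card => A; rewrite !inE andbC.
have cUx : #|U :\ x| = n by apply/eqP; rewrite -eqSS -cU (cardsD1 x U) xU.
have GU0 A : A \in G0 -> A \subset U :\ x.
  by rewrite inE subsetD1 => /andP[/GU -> ->].
have GU1 A : A \in G1 -> A \subset U :\ x.
  by case/imsetP => B; rewrite inE => /andP[/GU BU _] ->; rewrite setSD.
have := leq_add (IHn _ _ cUx GU0) (IHn _ _ cUx GU1); rewrite -cG.
set S0 := [set S | shattered G0 S]; set S1 := [set S | shattered G1 S].
move=> /leq_trans; apply.
have noX (H : {set {set T}}) S : (forall A, A \in H -> A \subset U :\ x) -> shattered H S -> x \notin S.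
  move=> HU /shatteredP/(_ S (subxx _))[A /HU]; rewrite subsetD1 => /andP[_ xA] AS.
  by apply: contra xA => xS; move: xS; rewrite -{1}AS inE => /andP[].
have shU S : (S \in S0) || (S \in S1) -> shattered G S.
  rewrite !inE => /orP[] sh.
    apply/shatteredP => B /(shatteredP _ _ sh)[A]; rewrite inE => /andP[AG _] <-.
    by exists A.
  have xS := noX _ _ GU1 sh.
  apply/shatteredP => B /(shatteredP _ _ sh)[_ /imsetP[A + ->]].
  rewrite inE => /andP[AG _] <-; exists A => //.
  by apply/setP => y; rewrite !inE; case: eqP => // -> /=; rewrite (negPf xS) andbF.
rewrite -cardsUI.
have xI : {in S0 :&: S1 &, injective (setU [set x])}.
  move=> S S'; rewrite !inE => /andP[/(noX _ _ GU0) xS _] /andP[/(noX _ _ GU0) xS' _] e.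
  by rewrite -(setU1K xS) e setU1K.
rewrite -(card_in_imset xI) -cardsUI.
rewrite [in X in _ + X](_ : _ :&: _ = set0) ?cards0 ?addn0; last first.
  apply/setP => S; rewrite !inE; apply/negP => /andP[/orP[] sh /imsetP[S' _ eS]].
    by have := noX _ _ GU0 sh; rewrite eS setU11.
  by have := noX _ _ GU1 sh; rewrite eS setU11.
rewrite subset_leq_card //; apply/subsetP => S.
rewrite in_setU => /orP[|/imsetP[S' + ->]].
  by rewrite in_setU inE => /shU.
rewrite !inE => /andP[sh0 sh1].
have xS' := noX _ _ GU0 sh0.
apply/shatteredP => B BS; have [xB|xB] := boolP (x \in B).
  have : B :\ x \subset S' by rewrite subDset.
  case/(shatteredP _ _ sh1) => _ /imsetP[A + ->]; rewrite inE => /andP[AG xA] e.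
  exists A => //; rewrite -(setD1K xB) -e; apply/setP => y; rewrite !inE.
  by case: eqP => // ->; rewrite xA.
have : B \subset S' by rewrite -(setU1K xS') subsetD1 xB BS.
case/(shatteredP _ _ sh0) => A; rewrite inE => /andP[AG xA] e.
exists A => //; rewrite -e; apply/setP => y; rewrite !inE.
by case: eqP => // -> /=; rewrite (negPf xA).
Qed.

Lemma sauer_shelah (T : finType) (F : {set {set T}}) (D : nat) :
  (forall S, shattered F S -> #|S| <= D) ->
  #|F| <= \sum_(i < D.+1) 'C(#|T|, i).
Proof.
move=> FD; apply: leq_trans (pajor F) _.
apply: (@leq_trans #|[set S : {set T} | #|S| < D.+1]|).
  by rewrite subset_leq_card //; apply/subsetP => S; rewrite !inE ltnS => /FD.
rewrite -sum1_card (partition_big (fun S : {set T} => inord #|S| : 'I_D.+1) predT) //=.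
apply: leq_sum => i _; rewrite -(cardsT T) -cards_draws -[leqRHS]sum1_card.
rewrite big_mkcond [leqRHS]big_mkcond /=; apply: leq_sum => S _.
rewrite !inE subsetT /=; case: ifP => // /andP[cS /eqP <-].
by rewrite inordK // eqxx.
Qed.

Import Order.TTheory GRing.Theory Num.Theory.
Local Open Scope ring_scope.

(** * Linear dependence, cones and duality *)

Definition dot (R : nzRingType) (D : nat) (v w : 'rV[R]_D) : R := (v *m w^T) 0 0.

Lemma dot_suml (R : comNzRingType) (D : nat) (J : finType) (I : {pred J})
    (c : J -> R) (v : J -> 'rV[R]_D) (w : 'rV[R]_D) :
  dot (\sum_(i in I) c i *: v i) w = \sum_(i in I) c i * dot (v i) w.
Proof.
rewrite /dot mulmx_suml summxE; apply: eq_bigr => i _.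
by rewrite -scalemxAl mxE.
Qed.

Lemma dot_sumr (R : comNzRingType) (D : nat) (J : finType) (I : {pred J})
    (c : J -> R) (v : J -> 'rV[R]_D) (w : 'rV[R]_D) :
  dot w (\sum_(i in I) c i *: v i) = \sum_(i in I) c i * dot w (v i).
Proof.
have dotC (a b : 'rV[R]_D) : dot a b = dot b a.
  by rewrite /dot -[a in LHS]trmxK -trmx_mul mxE.
by rewrite dotC dot_suml; apply: eq_bigr => i _; rewrite dotC.
Qed.

(** Replacing c by -c if necessary, a nontrivial relation can be taken to have a
    positive coefficient; this sign is all that its two uses require. *)
Lemma dependence (R : realFieldType) (D : nat) (J : finType) (I : {set J})
    (u : J -> 'rV[R]_D) : (D < #|I|)%N ->
  exists2 c : J -> R, \sum_(i in I) c i *: u i = 0 & exists2 i, i \in I & 0 < c i.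
Proof.
move=> DI; pose A := \matrix_(a < #|I|) u (enum_val a).
have /rowV0Pn[w wA w0] : kermx A != 0.
  rewrite -mxrank_eq0 mxrank_ker subn_eq0 -ltnNge.
  exact: leq_ltn_trans (rank_leq_col A) DI.
have [a wa] : exists a, w 0 a != 0.
  apply/existsP; rewrite -negb_forall; apply: contra w0 => /forallP w0.
  by apply/eqP/rowP => a; rewrite mxE; apply/eqP.
pose rk := enum_rank_in (enum_valP a).
have sum0 : \sum_(i in I) w 0 (rk i) *: u i = 0.
  rewrite big_enum_val /= (eq_bigr (fun b => w 0 b *: row b A)) => [|b _].
    by rewrite -mulmx_sum_row; apply/sub_kermxP.
  by rewrite rowK /rk enum_valK_in.
have [wa0|wa0] := ltP 0 (w 0 a).
  exists (fun i => w 0 (rk i)) => //; exists (enum_val a); first exact: enum_valP.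
  by rewrite /rk enum_valK_in.
exists (fun i => - w 0 (rk i)).
  rewrite (eq_bigr (fun i => - (w 0 (rk i) *: u i))) => [|i _]; last exact: scaleNr.
  by rewrite sumrN sum0 oppr0.
exists (enum_val a); first exact: enum_valP.
by rewrite /rk enum_valK_in oppr_gt0 lt_neqAle wa wa0.
Qed.

(** While more than D vectors are used, subtracting a multiple of a linear
    relation kills one coefficient; the least ratio c i / g i over g i > 0 keeps
    the others nonnegative. *)
Lemma conic_caratheodory (R : realFieldType) (D : nat) (J : finType)
    (I : {set J}) (u : J -> 'rV[R]_D) (c : J -> R) :
  (forall i, i \in I -> 0 <= c i) ->
  exists I' : {set J}, exists2 c' : J -> R,
    [/\ I' \subset I, (#|I'| <= D)%N & forall i, i \in I' -> 0 <= c' i] &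
    \sum_(i in I') c' i *: u i = \sum_(i in I) c i *: u i.
Proof.
elim: {I}_.+1 {-2}I c (ltnSn #|I|) => // n IHn I c ltIn c0.
have [ID|DI] := leqP #|I| D; first by exists I, c.
have [g sg [i0 i0I gi0]] := dependence u DI.
have P0 : (i0 \in I) && (0 < g i0) by rewrite i0I.
case: (@arg_minP _ _ _ i0 (fun i => (i \in I) && (0 < g i))
  (fun i => c i / g i) P0) => k /andP[kI gk] kmin.
pose t := c k / g k.
pose c1 i := c i - t * g i.
have c1k : c1 k = 0 by rewrite /c1 /t divfK ?subrr // gt_eqF.
have c10 i : i \in I :\ k -> 0 <= c1 i.
  rewrite !inE => /andP[_ iI]; rewrite subr_ge0.
  have [gi|gi] := ltP 0 (g i).
    by rewrite -ler_pdivlMr //; apply: kmin; rewrite iI.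
  apply: le_trans (c0 _ iI); rewrite mulr_ge0_le0 //.
  by rewrite divr_ge0 ?c0 // ltW.
have sum1 : \sum_(i in I :\ k) c1 i *: u i = \sum_(i in I) c i *: u i.
  transitivity (\sum_(i in I) c1 i *: u i).
    by rewrite [RHS](big_setD1 k) //= c1k scale0r add0r.
  rewrite (eq_bigr (fun i => c i *: u i - t *: (g i *: u i))).
    by rewrite sumrB -scaler_sumr sg scaler0 subr0.
  by move=> i _; rewrite scalerA -scalerBl.
have [|I' [c' [I'I cI' c'0] s']] := IHn (I :\ k) c1 _ c10.
  by move: ltIn; rewrite (cardsD1 k) kI.
exists I', c'; last by rewrite s'.
by split=> //; apply: subset_trans I'I _; apply: subD1set.
Qed.

(** The functionals are handled one at a time.  If b is not yet controlled by s,
    some x has a_j x <= 0 < b x for all j in s, which forces a_k x > 0.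
    Projecting along x onto the kernel of a_k (this is p) disposes of a_k, and
    undoing the projection gives a_k the weight t, which is nonnegative because
    b x > 0 >= a_j x. *)
Lemma farkas (R : realFieldType) (V : lmodType R) (J : eqType) (s : seq J)
    (a : J -> V -> R) (b : V -> R) :
  uniq s -> (forall j, scalar (a j)) -> scalar b ->
  (forall y, (forall j, j \in s -> a j y <= 0) -> b y <= 0) ->
  exists2 w : J -> R, (forall j, 0 <= w j) &
    forall y, b y = \sum_(j <- s) w j * a j y.
Proof.
elim: s a b => [|k s IHs] a b /=.
  move=> _ _ lb b_le0; exists (fun=> 0) => // y; rewrite big_nil.
  have bN : b (- y) = - b y.
    have := lb 1 y (- y); have := lb 1 0 0.
    by rewrite !scale1r addr0 subrr; lra.
  by apply/eqP; rewrite eq_le b_le0 //= -oppr_le0 -bN b_le0.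
move=> /andP[ks us] la lb hb.
have [hs|] := EM (forall y, (forall j, j \in s -> a j y <= 0) -> b y <= 0).
  have [w w0 bw] := IHs a b us la lb hs.
  exists (fun j => if j == k then 0 else w j).
    by move=> j; case: ifP.
  move=> y; rewrite big_cons eqxx mul0r add0r bw; apply: eq_big_seq => j js.
  by case: eqP => // jk; rewrite -jk js in ks.
move/existsNP => [x /not_implyP[ax /negP]]; rewrite -ltNge => bx.
have akx : 0 < a k x.
  rewrite ltNge; apply/negP => akx; move: bx; apply/negP; rewrite -leNgt.
  by apply: hb => j; rewrite inE => /orP[/eqP ->|/ax].
pose p f y : R := f y - f x / a k x * a k y.
have lp f : scalar f -> scalar (p f).
  by move=> lf c u v; rewrite /p lf la; ring.
have [j|y hy|w w0 bw] := IHs (fun j => p (a j)) (p b) us _ (lp b lb).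
- exact: lp.
- pose z := (- (a k y / a k x)) *: x + y.
  have zE f : scalar f -> f z = p f y.
    by move=> lf; rewrite /z lf /p; field; rewrite gt_eqF.
  rewrite -zE //; apply: hb => j; rewrite inE => /orP[/eqP ->|js].
    by rewrite zE // /p divff ?gt_eqF // mul1r subrr.
  by rewrite zE // hy.
pose t := b x / a k x - \sum_(j <- s) w j * (a j x / a k x).
exists (fun j => if j == k then t else w j).
  move=> j; case: ifP => // _; rewrite /t subr_ge0.
  apply: (@le_trans _ _ 0); last by rewrite divr_ge0 // ltW.
  rewrite big_seq sumr_le0 // => i /ax ai.
  by rewrite mulr_ge0_le0 // mulr_le0_ge0 // invr_ge0 ltW.
move=> y; rewrite big_cons eqxx.
have -> : b y = p b y + b x / a k x * a k y by rewrite /p subrK.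
rewrite bw /t mulrBl addrC -addrA; congr (_ + _).
rewrite addrC mulr_suml -sumrB; apply: eq_big_seq => j js.
case: eqP => [jk|_]; first by rewrite -jk js in ks.
by rewrite /p; ring.
Qed.

(** * Traces of half-spaces on a finite point set *)

Definition halfspace_trace (R : realFieldType) (D : nat) (X : finType)
    (u : X -> 'rV[R]_D) (v : 'rV[R]_D) : {set X} := [set p | 0 <= dot v (u p)].

Definition halfspace_traces (R : realFieldType) (D : nat) (X : finType)
    (u : X -> 'rV[R]_D) : {set {set X}} :=
  [set h | `[< exists v, h = halfspace_trace u v >]].

(** A linear relation between the points of S forbids one trace, the one that is
    nonnegative exactly where the coefficients are nonpositive: the relation would
    then be a sum of nonpositive terms, one of them negative.  So at most D
    points of R^D are shattered. *)
Lemma card_halfspace_traces (R : realFieldType) (D : nat) (X : finType)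
    (u : X -> 'rV[R]_D) :
  (#|halfspace_traces u| <= \sum_(i < D.+1) 'C(#|X|, i))%N.
Proof.
apply: sauer_shelah => S /shatteredP sh; rewrite leqNgt; apply/negP => DS.
have [c sc [i0 i0S ci0]] := dependence u DS.
have [|A] := sh [set i in S | c i <= 0].
  by apply/subsetP => i; rewrite !inE => /andP[].
rewrite inE => /asboolP[v ->] vS.
have sgn i : i \in S -> (0 <= dot v (u i)) = (c i <= 0).
  move=> iS; have /setP/(_ i) := vS; rewrite !inE iS /= andbT //.
have := dot_sumr S c u v; rewrite sc /dot trmx0 mulmx0 mxE -/(dot _ _).
apply/eqP; rewrite eq_sym lt_eqF // (bigD1 i0) //=.
have lt0 : c i0 * dot v (u i0) < 0.
  by rewrite pmulr_rlt0 // ltNge sgn // -ltNge.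
apply: le_lt_trans lt0; rewrite gerDl sumr_le0 // => i /andP[iS _].
have := sgn _ iS; have [ci /negbT|ci vi] := ltP 0 (c i).
  by rewrite -ltNge => vi; rewrite mulr_ge0_le0 // ltW.
by rewrite mulr_le0_ge0.
Qed.

(** * Separation of finitely many convex hulls *)

(** With a last coordinate equal to 1, affine half-spaces of R^d become linear
    half-spaces of R^(d+1). *)
Definition lift_pt (R : nzRingType) (d : nat) (x : 'rV[R]_d) : 'rV[R]_(d + 1) :=
  row_mx x 1%:M.

Lemma dot_lift (R : comNzRingType) (d : nat) (g x : 'rV[R]_d) (t : R) :
  dot (row_mx g t%:M) (lift_pt x) = dot g x + t.
Proof. by rewrite /dot /lift_pt tr_row_mx mul_row_col trmx1 mulmx1 !mxE eqxx mulr1n. Qed.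

Lemma dot_linear (R : comNzRingType) (d : nat) (x : 'rV[R]_d) : scalar (fun v => dot v x).
Proof. by move=> c u v; rewrite /dot mulmxDl -scalemxAl !mxE. Qed.

(** The alternative is linear programming duality for the system that asks for
    a point z common to all the convex hulls of the K i.  The point z is
    eliminated by prescribing that each barycentre equals the mean of all of
    them; on the dual side this is the projection P, whose rows P Y i sum to a
    multiple of the last basis vector e.  A dual solution thus gives v_i,
    nonnegative on K i, whose sum is a negative multiple of e.  Caratheodory's
    theorem keeps d+1 of them, and as e takes the value 1 at every lifted point,
    the half-spaces that remain have no common point. *)
Lemma hulls_meet_or_separate (R : realFieldType) (d r : nat) (X : finType)
    (x : X -> 'rV[R]_d) (K : 'I_r -> {set X}) : (0 < r)%N ->
  (exists w : 'I_r -> X -> R, exists2 z : 'rV[R]_d,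
     (forall i p, 0 <= w i p) &
     forall i, \sum_(p in K i) w i p = 1 /\ \sum_(p in K i) w i p *: x p = z)
  \/ exists I : {set 'I_r}, exists2 v : 'I_r -> 'rV[R]_(d + 1),
     (#|I| <= d.+1)%N /\
       (forall i p, i \in I -> p \in K i -> 0 <= dot (v i) (lift_pt (x p))) &
     forall y : 'rV[R]_d, exists2 i, i \in I & dot (v i) (lift_pt y) < 0.
Proof.
move=> r_gt0.
have r0 : r%:R != 0 :> R by rewrite pnatr_eq0 -lt0n.
pose PL (Y : 'M[R]_(r, d + 1)) : 'M[R]_(r, d + 1) := row_mx (lsubmx Y) 0.
pose P (Y : 'M[R]_(r, d + 1)) i : 'rV[R]_(d + 1) :=
  \row_k (Y i k - r%:R^-1 * \sum_l PL Y l k).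
have lP i c Y Z : P (c *: Y + Z) i = c *: P Y i + P Z i.
  apply/rowP => k; rewrite !mxE.
  have -> : PL (c *: Y + Z) = c *: PL Y + PL Z.
    rewrite /PL linearP /= scale_row_mx add_row_mx; congr row_mx.
    by rewrite scaler0 addr0.
  rewrite (eq_bigr (fun l => c * PL Y l k + PL Z l k)); last by move=> l _; rewrite !mxE.
  by rewrite big_split /= -mulr_sumr; ring.
pose a (q : 'I_r * X) Y := dot (P Y q.1) (lift_pt (x q.2)).
pose b (Y : 'M[R]_(r, d + 1)) := \sum_i Y i (rshift d ord0).
pose s := enum [pred q : 'I_r * X | q.2 \in K q.1].
have la q : scalar (a q) by move=> c Y Z; rewrite /a lP dot_linear.
have lb : scalar b.
  move=> c Y Z; rewrite /b mulr_sumr -big_split /=.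
  by apply: eq_bigr => i _; rewrite !mxE.
have [hb|] := EM (forall Y, (forall q, q \in s -> a q Y <= 0) -> b Y <= 0).
  left; have [w w0 bw] := farkas (enum_uniq _) la lb hb.
  (* Evaluating the identity bw at the matrix with single nonzero row g, in
     position i, recovers the equations of the primal system. *)
  pose T (i : 'I_r) (g : 'rV[R]_(d + 1)) : 'M[R]_(r, d + 1) :=
    \matrix_(l, k) ((l == i)%:R * g 0 k).
  have bT i g : b (T i g) = g 0 (rshift d ord0).
    rewrite /b (bigD1 i) //= mxE eqxx mul1r big1 ?addr0 // => l li.
    by rewrite mxE (negPf li) mul0r.
  have PT i g l : P (T i g) l = (l == i)%:R *: g - r%:R^-1 *: row_mx (lsubmx g) 0.
    apply/rowP => k; rewrite !mxE; congr (_ - _ * _).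
    rewrite (bigD1 i) //= big1 ?addr0 => [|m mi].
      by rewrite !mxE; case: split => j; rewrite !mxE // eqxx mul1r.
    by rewrite !mxE; case: split => j; rewrite !mxE // (negPf mi) mul0r.
  have main i (g : 'rV[R]_(d + 1)) : g 0 (rshift d ord0) =
      \sum_l \sum_(p in K l) w (l, p) * dot ((l == i)%:R *: g
         - r%:R^-1 *: row_mx (lsubmx g) 0) (lift_pt (x p)).
    rewrite -(bT i g) bw big_enum /= pair_big_dep /=.
    by apply: eq_bigr => -[l p] _; rewrite /a PT.
  have sel i (F : 'I_r -> R) : \sum_l (l == i)%:R * F l = F i.
    rewrite (bigD1 i) //= eqxx mul1r big1 ?addr0 // => l li.
    by rewrite (negPf li) mul0r.
  pose z := r%:R^-1 *: \sum_l \sum_(p in K l) w (l, p) *: x p.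
  exists (fun i p => w (i, p)); exists z; first by move=> i p.
  move=> i; split.
    have := main i (row_mx 0 1%:M); rewrite row_mxEr mxE eqxx mulr1n row_mxKl row_mx0.
    rewrite scaler0 => ->; rewrite -[LHS](sel i (fun l => \sum_(p in K l) w (l, p))).
    apply: eq_bigr => l _; rewrite mulr_sumr; apply: eq_bigr => p _.
    rewrite subr0 -[_ *: _]addr0 dot_linear dot_lift /dot mul0mx.
    by rewrite mxE add0r mulr1 mul0mx mxE addr0 mulrC.
  apply/rowP => k; have := main i (row_mx (delta_mx 0 k) 0).
  rewrite row_mxEr mxE row_mxKl => e.
  have dk p : dot (row_mx (delta_mx 0 k) 0) (lift_pt (x p)) = x p 0 k.
    have := dot_lift (delta_mx 0 k) (x p) 0; rewrite raddf0 => ->.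
    by rewrite addr0 /dot -rowE !mxE.
  have {}e : 0 = \sum_(p in K i) w (i, p) * x p 0 k
      - r%:R^-1 * \sum_l \sum_(p in K l) w (l, p) * x p 0 k.
    rewrite [LHS]e; have /= <- := sel i (fun l => \sum_(p in K l) w (l, p) * x p 0 k).
    rewrite mulr_sumr -sumrB; apply: eq_bigr => l _.
    rewrite !mulr_sumr -sumrB; apply: eq_bigr => p _.
    by rewrite dot_linear -scaleNr -[_ *: _]addr0 dot_linear dk /dot mul0mx mxE; ring.
  rewrite /z summxE mxE summxE; transitivity (\sum_(p in K i) w (i, p) * x p 0 k).
    by apply: eq_bigr => p _; rewrite mxE.
  rewrite (subr0_eq (esym e)); congr (_ * _); apply: eq_bigr => l _.
  by rewrite summxE; apply: eq_bigr => p _; rewrite mxE.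
move/existsNP => [Y /not_implyP[aY /negP]]; rewrite -ltNge => bY; right.
have sumP : \sum_i P Y i = row_mx 0 (b Y)%:M.
  apply/rowP => k; rewrite summxE.
  rewrite (eq_bigr (fun i => Y i k - r%:R^-1 * \sum_l PL Y l k)) => [|i _]; last first.
    by rewrite mxE.
  rewrite sumrB sumr_const card_ord -[X in _ - X]mulr_natl mulrA divff // mul1r.
  rewrite mxE; case: split_ordP => j -> .
    apply/eqP; rewrite mxE subr_eq0; apply/eqP/eq_bigr => l _.
    by rewrite row_mxEl mxE.
  rewrite (ord1 j) mxE eqxx mulr1n [X in _ - X]big1 ?subr0 // => l _.
  by rewrite row_mxEr mxE.
pose v i := - P Y i.
have [I [c [_ cI c0] sI]] := @conic_caratheodory _ _ _ [set: 'I_r] v (fun=> 1)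
  (fun _ _ => ler01).
exists I, v; first split; first by rewrite -[d.+1]addn1.
  move=> i p iI pK; rewrite /v -scaleN1r -[_ *: _]addr0 dot_linear.
  rewrite {2}/dot mul0mx mxE addr0 mulN1r oppr_ge0.
  by apply: (aY (i, p)); rewrite mem_enum.
move=> y; have : \sum_(i in I) c i * dot (v i) (lift_pt y) < 0.
  rewrite -dot_suml sI (eq_bigr (fun i => - P Y i)) => [|i _]; last by rewrite scale1r.
  rewrite big_mkcond /= (eq_bigr (fun i => - P Y i)) => [|i _]; last by rewrite inE.
  rewrite sumrN sumP opp_row_mx oppr0 -scalemx1 -scaleNr scalemx1 dot_lift.
  by rewrite /dot mul0mx mxE add0r oppr_lt0.
move=> lt0; have [[i iI vi]|no] := EM (exists2 i, i \in I & dot (v i) (lift_pt y) < 0).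
  by exists i.
exfalso; move: lt0; apply/negP; rewrite -leNgt sumr_ge0 // => i iI.
rewrite mulr_ge0 ?c0 // leNgt; apply/negP => vi.
by apply: no; exists i.
Qed.

(** Points are merged one at a time; since a partial sum of weights is not 1,
    the induction is on normalised combinations. *)
Lemma convex_comb (R : realType) (d : nat) (F : set 'rV[R]_d) (X : finType)
    (K : {set X}) (w : X -> R) (x : X -> 'rV[R]_d) :
  convex_set F -> (forall p, 0 <= w p) -> (forall p, p \in K -> F (x p)) ->
  \sum_(p in K) w p = 1 -> F (\sum_(p in K) w p *: x p).
Proof.
move=> cF w0 xF.
suff gen n : forall L : {set X}, #|L| = n -> L \subset K -> 0 < \sum_(p in L) w p ->
    F ((\sum_(p in L) w p)^-1 *: \sum_(p in L) w p *: x p).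
  move=> w1; have := gen #|K| K erefl (subxx _).
  by rewrite w1 invr1 scale1r; apply; apply: ltr01.
elim: n => [|n IHn] L cL LK wL.
  by move: wL; rewrite (cards0_eq cL) big_set0 ltxx.
have [p pL] : exists p, p \in L by apply/card_gt0P; rewrite cL.
have xp := xF p (subsetP LK p pL).
have cLp : #|L :\ p| = n by apply/eqP; rewrite -eqSS -cL (cardsD1 p L) pL.
have LpK : L :\ p \subset K by apply: subset_trans LK; apply: subD1set.
move: wL; rewrite !(big_setD1 p pL) /=; set t := \sum_(q in L :\ p) w q => wL.
set S := \sum_(q in L :\ p) w q *: x q.
have t0 : 0 <= t by apply: sumr_ge0.
move: t0; rewrite le_eqVlt => /orP[/eqP t0|t0].
  have -> : S = 0.
    rewrite /S big1 // => q qL; suff -> : w q = 0 by rewrite scale0r.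
    exact: (psumr_eq0P (fun i _ => w0 i) (esym t0)) qL.
  move: wL; rewrite -t0 !addr0 => wp.
  by rewrite scalerA mulVf ?scale1r // gt_eqF.
have := IHn _ cLp LpK t0; rewrite -/S => FS.
have l0 : 0 <= w p / (w p + t) by rewrite divr_ge0 // ltW.
have l1 : w p / (w p + t) <= 1 by rewrite ler_pdivrMr // mul1r lerDl ltW.
have := cF (x p) (t^-1 *: S) (Itv01 l0 l1) (mem_set xp) (mem_set FS).
move=> /set_mem; congr F; rewrite /conv /=.
rewrite !scalerDr !scalerA; congr (_ *: _ + _ *: _); first exact: mulrC.
by rewrite /unstable.onem; field; rewrite !gt_eqF.
Qed.

Definition separates (R : realType) (d r : nat) (X : finType) (x : X -> 'rV[R]_d)
    (F : 'I_r -> nat -> set 'rV[R]_d) (t : 'I_r -> nat) (I : {set 'I_r})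
    (v : 'I_r -> 'rV[R]_(d + 1)) : Prop :=
  (forall i p, i \in I -> F i (t i) (x p) -> 0 <= dot (v i) (lift_pt (x p))) /\
  forall y : 'rV[R]_d, exists2 i, i \in I & dot (v i) (lift_pt y) < 0.

Lemma transversal_separates (R : realType) (d r : nat) (X : finType)
    (x : X -> 'rV[R]_d) (F : 'I_r -> nat -> set 'rV[R]_d) (t : 'I_r -> nat) :
  (0 < r)%N -> (forall i k, convex_set (F i k)) ->
  ~ (exists z, forall i, F i (t i) z) ->
  exists I : {set 'I_r}, exists2 v, (#|I| <= d.+1)%N & separates x F t I v.
Proof.
move=> r0 cF noz; pose K i : {set X} := [set p | `[< F i (t i) (x p) >]]%SET.
have [[w [z w0 wz]]|[I [v [cI vI] vy]]] := hulls_meet_or_separate x K r0.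
  exfalso; apply: noz; exists z => i; have [w1 <-] := wz i.
  by apply: convex_comb => // p; rewrite inE => /asboolP.
exists I, v => //; split=> // i p iI Fp; apply: vI => //.
by rewrite inE; apply/asboolP.
Qed.

(** * Witnesses for an empty intersection *)

(** A slot q in Q holds one half-space together with the index (c q).1 of the
    convex set that it is meant to bound; kappa q i tells which piece of the i-th
    set is bounded if that index is i.  The labels kappa are fixed in advance,
    independently of the points and of the pieces, so that a witness is no more
    than a choice of c. *)
Definition encodes (R : realType) (d r : nat) (s : 'I_r -> nat) (Q : finType)
    (kappa : Q -> 'I_r -> nat) : Prop :=
  forall (X : finType) (x : X -> 'rV[R]_d) (F : 'I_r -> nat -> set 'rV[R]_d),
    (forall i k, convex_set (F i k)) ->
    ~ (exists z, forall i, exists2 k, (k < s i)%N & F i k z) ->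
  exists c : Q -> 'I_r * 'rV[R]_(d + 1),
    (forall q p, F (c q).1 (kappa q (c q).1) (x p) ->
                 0 <= dot (c q).2 (lift_pt (x p))) /\
    forall t, (forall i, (t i < s i)%N) -> forall p, exists2 q,
      kappa q (c q).1 = t (c q).1 & dot (c q).2 (lift_pt (x p)) < 0.

(** One slot for each choice t of a piece per index and each of the at most q
    half-spaces that separate this choice. *)
Lemma encoding_by_transversals (R : realType) (d r : nat) (s : 'I_r -> nat) :
  (0 < r)%N ->
  exists (Q : finType) (kappa : Q -> 'I_r -> nat),
    #|Q| = (minn r d.+1 * Sprod s)%N /\ encodes R d s kappa.
Proof.
move=> r0; pose T := {dffun forall i, 'I_(s i)}.
exists ((T * 'I_(minn r d.+1))%type : finType).
exists (fun (q : T * 'I_(minn r d.+1)) i => q.1 i : nat); split.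
  rewrite card_prod card_ord mulnC; congr (_ * _)%N.
  rewrite card_dep_ffun foldrE big_map big_enum.
  by apply: eq_bigr => i _; rewrite card_ord.
move=> X x F cF noz.
have sep (t : T) : exists g : 'I_(minn r d.+1) -> 'I_r * 'rV[R]_(d + 1),
    (forall e p, F (g e).1 (t (g e).1) (x p) -> 0 <= dot (g e).2 (lift_pt (x p))) /\
    forall y, exists e, dot (g e).2 (lift_pt y) < 0.
  have [|I [v cI [vI vy]]] := @transversal_separates R d r X x F (fun i => t i : nat) r0 cF.
    by move=> [z Fz]; apply: noz; exists z => i; exists (t i).
  have [i0 i0I _] := vy 0.
  have nthI e : nth i0 (enum I) e \in I.
    have [eI|eI] := ltnP e (size (enum I)); last by rewrite nth_default.
    by rewrite -mem_enum mem_nth.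
  (* If I has fewer elements than there are slots, the rest repeat i0. *)
  exists (fun e => (nth i0 (enum I) e, v (nth i0 (enum I) e))); split=> [e p /=|y].
    exact/vI/nthI.
  have [i iI vi] := vy y.
  have ltq : (index i (enum I) < minn r d.+1)%N.
    have : (index i (enum I) < #|I|)%N by rewrite cardE index_mem mem_enum.
    move=> /leq_trans; apply; rewrite leq_min cI andbT.
    by have := max_card (mem I); rewrite card_ord.
  by exists (Ordinal ltq); rewrite /= nth_index ?mem_enum.
have [g gP] := choice sep.
exists (fun q => g q.1 q.2); split=> [[t e] p|t ht p]; first exact: (gP t).1.
have [e ge] := (gP [ffun i => Ordinal (ht i)]).2 (x p).
by exists ([ffun i => Ordinal (ht i)], e) => //=; rewrite ffunE.
Qed.

(** One slot for each I, each choice of pieces indexed by I, and each i in I.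
    Whether the pieces can be separated depends on this partial choice alone, so
    complete choices that agree on I share their half-spaces. *)
Lemma encoding_by_partial_transversals (R : realType) (d r : nat) (s : 'I_r -> nat) :
  (0 < r)%N -> (forall i, 0 < s i)%N ->
  exists (Q : finType) (kappa : Q -> 'I_r -> nat),
    #|Q| = Hsum d s /\ encodes R d s kappa.
Proof.
move=> r0 s0; pose M := (\max_i s i)%N.
have sM i : (s i <= M)%N by apply: leq_bigmax.
pose B i := [pred k : 'I_M.+1 | (k < s i)%N].
(* Outside I the choice is normalised to 0, so that partial choices are not
   counted twice. *)
pose A : {pred {set 'I_r} * {ffun 'I_r -> 'I_M.+1} * 'I_r} :=
  [pred q | [&& q.1.1 != set0, (#|q.1.1| <= d.+1)%N,
      q.1.2 \in pfamily ord0 q.1.1 B & q.2 \in q.1.1]].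
exists ({q | A q} : finType), (fun (q : {q | A q}) i => (sval q).1.2 i : nat); split.
  have cB i : #|B i| = s i.
    rewrite -sum1_card -[RHS]card_ord -[RHS]sum1_card.
    by rewrite (big_ord_widen_cond M.+1 predT (fun=> 1%N)) // ltnW // ltnS.
  rewrite card_sig -sum1_card /Hsum.
  rewrite (eq_bigl (fun q => [&& q.1.1 != set0, (#|q.1.1| <= d.+1)%N
     & q.1.2 \in pfamily ord0 q.1.1 B] && (q.2 \in q.1.1))); last first.
    by move=> q; rewrite -!andbA.
  rewrite -(pair_big_dep (fun q : {set 'I_r} * {ffun 'I_r -> 'I_M.+1} =>
    [&& q.1 != set0, (#|q.1| <= d.+1)%N & q.2 \in pfamily ord0 q.1 B])
    (fun q i => i \in q.1) (fun _ _ => 1%N)) /=.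
  rewrite (eq_bigl (fun q => ((q.1 != set0) && (#|q.1| <= d.+1)%N)
     && (q.2 \in pfamily ord0 q.1 B))); last by move=> q; rewrite -!andbA.
  rewrite -(pair_big_dep (fun I : {set 'I_r} => (I != set0) && (#|I| <= d.+1)%N)
    (fun I t => t \in pfamily ord0 I B) (fun I _ => \sum_(i in I) 1)%N) /=.
  apply: eq_bigr => I _; rewrite sum1_card sum_nat_const mulnC; congr (_ * _)%N.
  rewrite card_pfamily foldrE big_map big_enum /=.
  by apply: eq_bigr => i _; rewrite cB.

move=> X x F cF noz.
have sep (q : {set 'I_r} * {ffun 'I_r -> 'I_M.+1}) : exists v,
    (forall i p, i \in q.1 -> F i (q.2 i) (x p) -> 0 <= dot (v i) (lift_pt (x p))) /\
    ((exists v, separates x F (fun i => q.2 i : nat) q.1 v) ->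
     forall y, exists2 i, i \in q.1 & dot (v i) (lift_pt y) < 0).
  have [[v hv]|no] := EM (exists v, separates x F (fun i => q.2 i : nat) q.1 v).
    by exists v; split; [apply: hv.1 | move=> _; apply: hv.2].
  (* A partial choice that cannot be separated gets half-spaces that bound
     nothing. *)
  exists (fun=> 0); split=> // i p _ _; by rewrite /dot mul0mx mxE.
have [v vP] := choice sep.
exists (fun q => ((sval q).2, v (sval q).1 (sval q).2)); split.
  by case=> [[It i] /= AI] p; apply: (vP It).1; case/and4P: AI.
move=> t ht p.
have [|I [u cI [uI uy]]] := @transversal_separates R d r X x F t r0 cF.
  by move=> [z Fz]; apply: noz; exists z => i; exists (t i).
pose tI : {ffun 'I_r -> 'I_M.+1} := [ffun i => if i \in I then inord (t i) else ord0].
have tIE i : i \in I -> tI i = t i :> nat.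
  by move=> iI; rewrite ffunE iI inordK // ltnS ltnW // (leq_trans (ht i)).
have [|i iI vi] := (vP (I, tI)).2 _ (x p).
  by exists u; split=> // i p' iI; rewrite /= tIE //; apply: uI.
have AI : A (I, tI, i).
  apply/and4P; split=> //=; first by apply/set0Pn; exists i.
  apply/pfamilyP; split=> [|j jI]; last by rewrite inE /= tIE.
  by apply/subsetP => j; rewrite inE ffunE; case: ifP => //; rewrite eqxx.
by exists (exist _ (I, tI, i) AI) => //=; rewrite tIE.
Qed.

(** The sample points of the i-th set allowed by a witness: the union over its
    pieces k of the intersections of the half-spaces that bound this piece. *)
Definition region (r : nat) (X Q : finType) (s : 'I_r -> nat)
    (kappa : Q -> 'I_r -> nat) (c : {ffun Q -> 'I_r * {set X}}) (i : 'I_r) :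
    {set X} :=
  [set p | [exists k : 'I_(s i), forall q,
     (((c q).1 == i) && (kappa q i == k)) ==> (p \in (c q).2)]].

(** * From witnesses to rainbow partitions *)

Lemma s_convex_pieces (R : realType) (d s : nat) (C : set 'rV[R]_d) : s_convex s C ->
  exists F : nat -> set 'rV[R]_d, (forall k, convex_set (F k)) /\
    forall z, C z <-> exists2 k, (k < s)%N & F k z.
Proof.
move=> [n ns [F cF ->]].
exists (fun k => if insub k is Some j then F j else classical_sets.set0); split=> [k|z].
  case: insub => [j|]; first exact: cF.
  by move=> u v l /set_mem.
split=> [[j _ Fj]|[k ks]].
  by exists j; [apply: leq_trans ns | rewrite valK].
by case: insubP => // j _ _ Fj; exists j.
Qed.

Lemma card_eq_II_enum (T : Type) (A : set T) (r : nat) : (A #= `I_r)%card ->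
  exists f : 'I_r -> T, injective f /\ forall z, A z <-> exists k, f k = z.
Proof.
rewrite card_eq_sym => /card_bijP[f [g fK gK]].
pose e (k : 'I_r) : `I_r%classic := SigSub (mem_set (ltn_ord k : `I_r%classic k)).
exists (fun k => \val (f (e k))); split=> [k l /val_inj/(can_inj fK)[]|z].
  exact: val_inj.
split=> [Az|[k <-]]; last exact/set_mem/valP.
pose y : A := SigSub (mem_set Az); have gr := set_mem (valP (g y)).
exists (Ordinal gr); rewrite (_ : e _ = g y) ?gK //.
exact: val_inj.
Qed.

(** The witnesses to be excluded are the encodings c whose regions have no common
    sample point.  If the C_i had no common point, their encoding would be such a
    witness, with all of P_i in the i-th region, against the choice of the
    labelling. *)
Lemma tverberg_of_encoding (R : realType) (d r m : nat) (s : 'I_r -> nat)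
    (Q : finType) (kappa : Q -> 'I_r -> nat) :
  (0 < r)%N -> encodes R d s kappa ->
  ((r * \sum_(i < d.+2) 'C(m * r, i)) ^ #|Q| < 2 ^ m)%N ->
  colorful_tverberg R d s m.
Proof.
move=> r0 enc small A cA tA.
have [f fP] := choice (fun j => card_eq_II_enum (cA j)).
pose x (p : 'I_m * 'I_r) := f p.1 p.2.
have xinj : injective x.
  move=> [j k] [l n] xe; have jl : j = l.
    apply: (tA j l) => //; exists (x (j, k)); split.
      by apply/(fP j).2; exists k.
    by rewrite xe; apply/(fP l).2; exists n.
  by move: xe; rewrite -jl => /(fP j).1 /= ->.
have xA p : A p.1 (x p) by apply/(fP p.1).2; exists p.2.
pose H := halfspace_traces (fun p => lift_pt (x p)).
pose G := [set c : {ffun Q -> 'I_r * {set 'I_m * 'I_r}} |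
  [forall q, (c q).2 \in H] && [forall p, exists i, p \notin region s kappa c i]].
have cG : (#|G| < 2 ^ m)%N.
  apply: leq_ltn_trans small; pose B := [pred y : 'I_r * {set 'I_m * 'I_r} | y.2 \in H].
  apply: (@leq_trans #|(ffun_on B : simpl_pred {ffun Q -> _})|).
    rewrite subset_leq_card //; apply/subsetP => c; rewrite inE => /andP[/forallP cH _].
    by apply/ffun_onP => q; apply: cH.
  rewrite card_ffun_on.
  have le_B : (#|B| <= r * \sum_(i < d.+2) 'C(m * r, i))%N.
    have -> : #|B| = (r * #|H|)%N.
      transitivity (#|'I_r| * #|H|)%N; last by rewrite card_ord.
      by rewrite -cardX; apply: eq_card => -[i h]; rewrite !inE.
    rewrite leq_mul2l; apply/orP; right.
    apply: leq_trans (card_halfspace_traces _) _.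
    by rewrite card_prod !card_ord addn1.
  by case: #|Q| => [//|n]; rewrite leq_exp2r.
have [|sg sgP] := union_bound r0 cG (Q := fun c => region s kappa c).
  by move=> c p; rewrite inE => /andP[_ /forallP/(_ p)/existsP].
pose P (i : 'I_r) : set 'rV[R]_d := [set z | exists2 p, sg p.1 p.2 = i & x p = z]%classic.
exists P; first split.
- apply/seteqP; split=> z.
    by move=> [i _ [p _ <-]]; exists p.1.
  by move=> [j _ /(fP j).2[k <-]]; exists (sg j k) => //; exists (j, k).
- by move=> i k _ _ [z [[p <- pz] [q <- qz]]]; rewrite (xinj p q) // pz qz.
- move=> i j; pose z := x (j, (sg j)^-1%g i).
  suff -> : (P i `&` A j)%classic = [set z]%classic by exact: card_set1.
  apply/seteqP; split=> [_ [[p pi <-] pj]|_ ->]; last first.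
    by split; [exists (j, (sg j)^-1%g i); rewrite ?permKV | exact: (xA (j, (sg j)^-1%g i))].
  have pj1 : p.1 = j by apply: tA => //; exists (x p).
  rewrite /z -pi -pj1 permK; by case: (p).
move=> C cC PC; apply: contrapT => Cno.
have [F FP] := choice (fun i => s_convex_pieces (cC i)).
have [|c [c1 c2]] := enc _ x F (fun i => (FP i).1).
  move=> [z Fz]; apply: Cno; exists z => i _; apply/(FP i).2; exact: Fz.
pose cc := [ffun q => ((c q).1, halfspace_trace (fun p => lift_pt (x p)) (c q).2)].
have ccG : cc \in G.
  rewrite inE; apply/andP; split; apply/forallP; [move=> q|move=> p].
    by rewrite ffunE inE; apply/asboolP; exists (c q).2.
  rewrite -negb_forall; apply/negP => /forallP all_in.
  have hk i : exists k : 'I_(s i), forall q, (c q).1 = i -> kappa q i = k ->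
      0 <= dot (c q).2 (lift_pt (x p)).
    have := all_in i; rewrite inE => /existsP[k /forallP hk]; exists k => q ci ki.
    by have := hk q; rewrite ffunE /= ci ki !eqxx /= inE.
  pose t i : nat := projT1 (cid (hk i)).
  have [|q qt qlt] := c2 t _ p; first by move=> i; rewrite /t.
  have := projT2 (cid (hk (c q).1)) q erefl qt.
  by rewrite leNgt qlt.
have [p /negP] := sgP _ ccG; apply; rewrite inE.
have [k ks Fk] : exists2 k, (k < s (sg p.1 p.2))%N & F (sg p.1 p.2) k (x p).
  by apply/(FP _).2; apply: PC; exists p.
apply/existsP; exists (Ordinal ks); apply/forallP => q; rewrite ffunE /=.
apply/implyP => /andP[/eqP ci /eqP ki]; rewrite inE; apply: c1.
by rewrite ci ki.
Qed.

(** * The number of sets needed *)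

(** Chernoff's argument: with x = D/n <= 1, the sum times x^D is at most
    (1+x)^n <= e^D. *)
Lemma ln_sum_binom (R : realType) (D n : nat) : (0 < D <= n)%N ->
  ln (\sum_(i < D.+1) 'C(n, i))%:R <= D%:R * (1 + ln (n%:R / D%:R)) :> R.
Proof.
move=> /andP[D0 Dn].
have DR : 0 < D%:R :> R by rewrite ltr0n.
have nR : 0 < n%:R :> R by rewrite ltr0n (leq_trans D0).
pose S : R := (\sum_(i < D.+1) 'C(n, i))%:R; rewrite -/S.
have S0 : 0 < S by rewrite ltr0n big_ord_recl bin0.
pose x : R := D%:R / n%:R.
have x0 : 0 < x by rewrite divr_gt0.
have x1 : x <= 1 by rewrite ler_pdivrMr // mul1r ler_nat.
have le_pow : S * x ^+ D <= (1 + x) ^+ n.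
  rewrite exprDn /S natr_sum mulr_suml.
  rewrite (big_ord_widen n.+1 (fun i => 'C(n, i)%:R * x ^+ D)) ?ltnS //.
  rewrite big_mkcond /=; apply: ler_sum => i _; case: ifP => iD.
    rewrite expr1n mul1r -[leRHS]mulr_natl ler_wpM2l ?ler0n //.
    by apply: ler_wiXn2l; rewrite ?(ltW x0).
  by rewrite expr1n mul1r mulrn_wge0 // exprn_ge0 // ltW.
have : S * x ^+ D <= expR (x * n%:R).
  apply: le_trans le_pow _; rewrite mulrC expRM_natl lerXn2r ?nnegrE ?expR_ge0 //.
    by rewrite addr_ge0 // ltW.
  exact: expR_ge1Dx.
have -> : x * n%:R = D%:R by rewrite /x divfK // gt_eqF.
rewrite -ler_ln ?posrE ?expR_gt0 ?mulr_gt0 ?exprn_gt0 // expRK.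
rewrite lnM ?posrE ?exprn_gt0 // lnXn // -[x]invrK lnV ?posrE ?invr_gt0 //.
by rewrite /x invf_div -mulr_natl; lra.
Qed.

Lemma ln2_ge_half (R : realType) : 1 / 2 <= ln 2 :> R.
Proof.
have := @le_ln1Dx R (- (1 / 2)) _; rewrite (_ : 1 + _ = 2^-1); last by lra.
by rewrite lnV ?posrE // => /(_ _); lra.
Qed.

(** Writing B = d T L, one has n/(d+1) <= 64 r T L for n = m r, so its logarithm
    is at most 5 + 2 L and T (ln r + ln N) <= 17 B; this is below m ln 2
    because m > 63 B and ln 2 >= 1/2. *)
Lemma union_bound_size (R : realType) (r d T : nat) :
  (0 < r)%N -> (0 < d)%N -> (0 < T)%N ->
  let L : R := ln (expR 1 * r%:R * T%:R) in
  exists2 m : nat, ((r * \sum_(i < d.+2) 'C(m * r, i)) ^ T < 2 ^ m)%N &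
    m%:R <= 64 * d%:R * T%:R * L.
Proof.
move=> r0 d0 T0 L.
have rR : 1 <= r%:R :> R by rewrite ler1n.
have dR : 1 <= d%:R :> R by rewrite ler1n.
have TR : 1 <= T%:R :> R by rewrite ler1n.
have r_gt0 := lt_le_trans ltr01 rR; have d_gt0 := lt_le_trans ltr01 dR.
have T_gt0 := lt_le_trans ltr01 TR.
have LE : L = 1 + ln r%:R + ln T%:R.
  by rewrite /L !lnM ?posrE ?mulr_gt0 ?expR_gt0 // expRK.
clearbody L.
have lnr : 0 <= ln r%:R :> R by apply: ln_ge0.
have lnT : 0 <= ln T%:R :> R by apply: ln_ge0.
have L1 : 1 <= L by rewrite LE; lra.
have L0 := lt_le_trans ltr01 L1.
pose B := d%:R * T%:R * L.
have B1 : d%:R <= B.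
  by rewrite /B -mulrA ler_peMr ?(ltW d_gt0) // mulr_ege1.
have [m mlo mhi] : exists2 m : nat, 63 * B < m%:R & m%:R <= 64 * B.
  exists (Num.truncn (63 * B)).+1; first exact: truncnS_gt.
  have : (Num.truncn (63 * B))%:R <= 63 * B by rewrite truncn_le; lra.
  by rewrite -natr1; lra.
exists m; last by rewrite /B !mulrA in mhi.
have n_ge : (d.+1 <= m * r)%N.
  have dm : (d < m)%N by rewrite -(ltr_nat R); lra.
  by apply: leq_trans dm _; rewrite leq_pmulr.
have mr0 : (0 < m * r)%N by apply: leq_trans n_ge.
have lnS := @ln_sum_binom R d.+1 (m * r) n_ge.
set S := (\sum_(i < d.+2) 'C(m * r, i))%N in lnS *.
have S0 : (0 < S)%N by rewrite /S big_ord_recl bin0.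
have lnn : ln ((m * r)%:R / d.+1%:R) <= 5 + 2 * L :> R.
  apply: (@le_trans _ _ (ln (64 * (r%:R * T%:R) * L))).
    rewrite ler_ln ?posrE ?divr_gt0 ?mulr_gt0 ?ltr0n //.
    rewrite ler_pdivrMr ?ltr0n // natrM.
    apply: (@le_trans _ _ (64 * B * r%:R)); first by rewrite ler_pM2r.
    rewrite /B (_ : 64 * _ * _ = 64 * (r%:R * T%:R) * L * d%:R); last by ring.
    by rewrite ler_wpM2l ?ler_nat // !mulr_ge0 // ltW.
  rewrite !lnM ?posrE ?mulr_gt0 //.
  have l64 : ln 64 <= 6 :> R.
    have -> : 64 = 2 ^+ 6 :> R by ring.
    have l2 : ln 2 <= 1 :> R by apply: (@le_ln1Dx R 1); lra.
    by rewrite lnXn // -[leLHS]mulr_natl; lra.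
  have lnL := ln_sublinear L0.
  lra.
rewrite -(ltr_nat R) !natrX natrM -ltr_ln ?posrE ?exprn_gt0 ?mulr_gt0 ?ltr0n //.
rewrite !lnXn ?mulr_gt0 ?ltr0n // lnM ?posrE ?ltr0n //.
have dS : d.+1%:R <= 2 * d%:R :> R by rewrite -natr1; lra.
have lnS' : ln S%:R <= 16 * (d%:R * L) :> R.
  apply: le_trans lnS _; apply: (@le_trans _ _ (2 * d%:R * (8 * L))); last by lra.
  apply: (@le_trans _ _ (d.+1%:R * (8 * L))); first by rewrite ler_wpM2l //; lra.
  by rewrite ler_wpM2r //; lra.
have rL : ln r%:R <= d%:R * L :> R.
  by apply: (@le_trans _ _ L); [lra | rewrite ler_peMl // ltW].
rewrite -[ltLHS]mulr_natl -[ltRHS]mulr_natl.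
apply: (@le_lt_trans _ _ (T%:R * (17 * (d%:R * L)))); first by rewrite ler_wpM2l //; lra.
have -> : T%:R * (17 * (d%:R * L)) = 17 * B by rewrite /B; ring.
apply: (@lt_le_trans _ _ (m%:R * (1 / 2))); first by lra.
by rewrite ler_wpM2l // ln2_ge_half.
Qed.

Lemma Tmin_gt0 (d r : nat) (s : 'I_r -> nat) :
  (0 < r)%N -> (forall i, 0 < s i)%N -> (0 < Tmin d s)%N.
Proof.
move=> r0 s0; rewrite /Tmin leq_min; apply/andP; split.
  by rewrite muln_gt0 leq_min r0 /= prodn_gt0.
pose I := [set Ordinal r0].
rewrite /Hsum (bigD1 I) /=; last first.
  by rewrite cards1 andbT; apply/set0Pn; exists (Ordinal r0); rewrite inE.
by rewrite ltn_addr // muln_gt0 cards1 prodn_gt0.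
Qed.

Theorem theorem1p6 (R : realType) :
  exists c : R,
  forall (r d : nat) (s : 'I_r -> nat),
    (2 <= r)%N -> (1 <= d)%N -> (forall i : 'I_r, (1 <= s i)%N) ->
  exists2 m : nat, is_g R d s m &
    m%:R <= c * d%:R * (Tmin d s)%:R * ln (expR 1 * r%:R * (Tmin d s)%:R).
Proof.
exists 64 => r d s r2 d1 s1; have r0 : (0 < r)%N by apply: ltnW.
have [Q [kappa [cQ enc]]] : exists (Q : finType) (kappa : Q -> 'I_r -> nat),
    #|Q| = Tmin d s /\ encodes R d s kappa.
  rewrite /Tmin /minn; case: ifP => _; first exact: encoding_by_transversals.
  exact: encoding_by_partial_transversals.
have [m small le_m] := union_bound_size R r0 d1 (Tmin_gt0 d r0 s1).
rewrite -cQ in small; have tm := tverberg_of_encoding r0 enc small.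
have ex : exists k, `[< colorful_tverberg R d s k >] by exists m; apply/asboolP.
exists (ex_minn ex); case: ex_minnP => k /asboolP tk kmin.
  by split=> // l tl; apply: kmin; apply/asboolP.
by apply: le_trans le_m; rewrite ler_nat; apply: kmin; apply/asboolP.
Qed.
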